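(* Let $b$ be an invariant form of a Bol superalgebra $B=B_0\oplus B_1$. Then (1) $(B\cdot B+[B,B,B])^\perp=Z(B)$ if $b$ is nondegenerate; (2) if $I$ is an ideal of $B$, then $I^\perp$ is an ideal of $B$. In particular, $B^\perp$ is an ideal of $B$.
   Context: All vector superspaces and superalgebras are finite dimensional over a fixed field $\mathbb{K}$ of characteristic $0$; $\bar x\in\mathbb{Z}_2$ denotes the parity of a homogeneous element $x$. A Bol superalgebra is a superspace $B=B_0\oplus B_1$ with a bilinear operation $(x,y)\mapsto x\cdot y=xy$, $B_i\cdot B_j\subseteq B_{i+j}$, and a trilinear operation $[\,,\,,\,]$, $[B_i,B_j,B_k]\subseteq B_{i+j+k}$, such that for all homogeneous $x,y,z,u,v,w$: (BS1) $x\cdot y=-(-1)^{\bar x\bar y}y\cdot x$; (BS2) $[x,y,z]=-(-1)^{\bar x\bar y}[y,x,z]$; (BS3) $[x,y,z]+(-1)^{\bar x(\bar y+\bar z)}[y,z,x]+(-1)^{\bar z(\bar x+\bar y)}[z,x,y]=0$; (BS4) $[x,y,[u,v,w]]=[[x,y,u],v,w]+(-1)^{\bar u(\bar x+\bar y)}[u,[x,y,v],w]+(-1)^{(\bar x+\bar y)(\bar u+\bar v)}[u,v,[x,y,w]]$; (BS5) $[x,y,u\cdot v]=(-1)^{\bar u(\bar x+\bar y)}u\cdot[x,y,v]+[x,y,u]\cdot v+(-1)^{(\bar x+\bar y)(\bar u+\bar v)}[u,v,x\cdot y]+(x\cdot y)\cdot(u\cdot v)$. An invariant form of $B$ is a supersymmetric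 bilinear form $b$ on $B$ (i.e. $b(x,y)=(-1)^{\bar x\bar y}b(y,x)$ for homogeneous $x,y$) such that for all $x,y,z,u\in B_0\cup B_1$: $b(xy,z)=-(-1)^{\bar x\bar y}b(y,xz)$ and $b([x,y,z],u)=-(-1)^{\bar y(\bar z+\bar u)}b(x,[z,u,y])$. For a subset $V\subseteq B$, $V^\perp=\{x\in B: b(x,y)=0\ \forall y\in V\}$; $b$ is nondegenerate if $B^\perp=\{0\}$. $B\cdot B$ and $[B,B,B]$ denote the spans of all products $xy$ and $[x,y,z]$. The center is $Z(B)=\{x\in B: xy=0\text{ and }[x,y,z]=0\ \forall y,z\in B\}$. An ideal of $B$ is a graded subspace $I=I_0\oplus I_1$ with $BI\subseteq I$ and $[B,I,B]\subseteq I$.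
   Formalization: In part (2), including the claim on B^⊥, the form b is additionally assumed homogeneous (even or odd with respect to the grading), since for a form of mixed parity I^⊥ and B^⊥ need not be graded and the claim fails. *)

(* Defs.v *)
From HB Require Import structures.
From mathcomp Require Import all_boot all_order all_algebra.

Set Implicit Arguments.
Unset Strict Implicit.
Unset Printing Implicit Defensive.

Import GRing.Theory.
Local Open Scope ring_scope.

(* Parities are booleans (true = odd), added with (+) and multiplied with &&.
   An identity for homogeneous elements quantifies over x \in hpart S i for
   every parity i; x = 0 has both parities, where multilinear identities are
   trivially true. *)
Record bolSuperalgebra (K : fieldType) (B : vectType K) := BolSuperalgebra {
  hpart : bool -> {vspace B};
  bmul : {bilinear B -> B -> B};
  btri : B -> {bilinear B -> B -> B};
  btri_linear : forall y z, linear (fun x => btri x y z);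
  hpart_full : (hpart false + hpart true = fullv)%VS;
  hpart_direct : directv (hpart false + hpart true);
  bmul_hpart : forall i j x y,
    x \in hpart i -> y \in hpart j -> bmul x y \in hpart (i (+) j);
  btri_hpart : forall i j k x y z,
    x \in hpart i -> y \in hpart j -> z \in hpart k ->
    btri x y z \in hpart (i (+) j (+) k);
  BS1 : forall i j x y,
    x \in hpart i -> y \in hpart j ->
    bmul x y = - ((-1) ^+ (i && j) *: bmul y x);
  BS2 : forall i j k x y z,
    x \in hpart i -> y \in hpart j -> z \in hpart k ->
    btri x y z = - ((-1) ^+ (i && j) *: btri y x z);
  BS3 : forall i j k x y z,
    x \in hpart i -> y \in hpart j -> z \in hpart k ->
    btri x y z + (-1) ^+ (i && (j (+) k)) *: btri y z x
      + (-1) ^+ (k && (i (+) j)) *: btri z x y = 0;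
  BS4 : forall i j k l m x y u v w,
    x \in hpart i -> y \in hpart j ->
    u \in hpart k -> v \in hpart l -> w \in hpart m ->
    btri x y (btri u v w)
    = btri (btri x y u) v w
      + (-1) ^+ (k && (i (+) j)) *: btri u (btri x y v) w
      + (-1) ^+ ((i (+) j) && (k (+) l)) *: btri u v (btri x y w);
  BS5 : forall i j k l x y u v,
    x \in hpart i -> y \in hpart j -> u \in hpart k -> v \in hpart l ->
    btri x y (bmul u v)
    = (-1) ^+ (k && (i (+) j)) *: bmul u (btri x y v)
      + bmul (btri x y u) v
      + (-1) ^+ ((i (+) j) && (k (+) l)) *: btri u v (bmul x y)
      + bmul (bmul x y) (bmul u v)
}.

Section BolSuperalgebraTheory.
Variables (K : fieldType) (B : vectType K) (S : bolSuperalgebra B).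
Implicit Types (b : {biscalar B}) (I V : {vspace B}).

Local Notation "x '*b' y" := (bmul S x y) (at level 40, left associativity).
Local Notation "[b x , y , z ]" := (btri S x y z) (format "[b x ,  y ,  z ]").

(* By bilinearity and trilinearity, the products of basis vectors span all
   products; see [bmulspan_subv] and [btrispan_subv]. *)
Definition bmulspan : {vspace B} :=
  <<[seq x *b y | x <- vbasis {:B}, y <- vbasis {:B}]>>%VS.

Definition btrispan : {vspace B} :=
  <<[seq [b p.1, p.2, z] |
      p <- [seq (x, y) | x <- vbasis {:B}, y <- vbasis {:B}],
      z <- vbasis {:B}]>>%VS.

(* See [memv_bol_center]; [linfun f] agrees with f only when f is linear, which
   holds here and in [form_perp]. *)
Definition bol_center : {vspace B} :=
  (\bigcap_(y <- vbasis {:B})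
     (lker (linfun (fun x => x *b y)) :&:
      \bigcap_(z <- vbasis {:B}) lker (linfun (fun x => [b x, y, z]))))%VS.

Definition graded_subspace I : bool :=
  (I == I :&: hpart S false + I :&: hpart S true)%VS.

Definition bol_ideal I : Prop :=
  [/\ graded_subspace I,
      forall x y, y \in I -> x *b y \in I
    & forall x y z, y \in I -> [b x, y, z] \in I].

Definition supersymmetric_form b : Prop :=
  forall i j x y, x \in hpart S i -> y \in hpart S j ->
    b x y = (-1) ^+ (i && j) * b y x.

Definition invariant_form b : Prop :=
  [/\ supersymmetric_form b,
      forall i j k x y z,
        x \in hpart S i -> y \in hpart S j -> z \in hpart S k ->
        b (x *b y) z = - ((-1) ^+ (i && j) * b y (x *b z))
    & forall i j k l x y z u,
        x \in hpart S i -> y \in hpart S j ->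
        z \in hpart S k -> u \in hpart S l ->
        b [b x, y, z] u = - ((-1) ^+ (j && (k (+) l)) * b x [b z, u, y])].

(* b is homogeneous of degree p: for p = false, b is even (consistent), i.e.
   b(B_0, B_1) = 0; for p = true, b is odd, i.e. b(B_0, B_0) = b(B_1, B_1) = 0.
   The orthogonal of a graded subspace need not be graded otherwise: for the
   zero products on K e + K f, e even and f odd, the form b(e, e) = b(e, f) =
   b(f, e) = 1, b(f, f) = 0 is invariant and <e>^perp = <e - f>. *)
Definition homogeneous_form (p : bool) b : Prop :=
  forall i j x y, x \in hpart S i -> y \in hpart S j ->
    i (+) j != p -> b x y = 0.

(* See [memv_form_perp]. *)
Definition form_perp b V : {vspace B} :=
  (\bigcap_(y <- vbasis V) lker (linfun (fun x => b x y : K^o)))%VS.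

Definition nondegenerate_form b : Prop := form_perp b fullv = 0%VS.

Lemma memv_lker_linfun (W : vectType K) (f : B -> W) x :
  linear f -> (x \in lker (linfun f)) = (f x == 0).
Proof.
move=> lf; pose F := GRing.isLinear.Build K B W *:%R f lf.
pose g : {linear B -> W} := HB.pack f F.
by rewrite memv_ker -[f]/(g : B -> W) lfunE.
Qed.

Lemma memv_bigcap (T : eqType) (s : seq T) (U : T -> {vspace B}) x :
  reflect {in s, forall y, x \in U y} (x \in \bigcap_(y <- s) U y)%VS.
Proof.
elim: s => [|a s IHs]; first by rewrite big_nil memvf; left.
rewrite big_cons memv_cap; apply: (iffP andP) => [[xa /IHs xs] y|xs].
  by rewrite inE => /predU1P[->|/xs].
split; first by rewrite xs ?mem_head.
by apply/IHs=> y ys; rewrite xs // inE ys orbT.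
Qed.

Lemma vbasis_linear0 (V : {vspace B}) (W : lmodType K) (f : B -> W) :
  linear f -> {in vbasis V, forall y, f y = 0} -> {in V, forall y, f y = 0}.
Proof.
move=> lf f0 y /coord_vbasis ->.
pose F := GRing.isLinear.Build K B W *:%R f lf.
pose g : {linear B -> W} := HB.pack f F.
rewrite -[f]/(g : B -> W) linear_sum big1 // => i _.
by rewrite linearZ /= f0 ?scaler0 // mem_nth ?size_tuple.
Qed.

Lemma memv_form_perp b V x :
  reflect {in V, forall y, b x y = 0} (x \in form_perp b V).
Proof.
have lb y : linear (fun x => b x y : K^o).
  by move=> a u v; rewrite linearPl.
apply: (iffP (memv_bigcap _ _ _)) => [bx|bx y /vbasis_mem yV]; last first.
  by rewrite memv_lker_linfun // bx.
apply: (@vbasis_linear0 V K^o (b x)) => [a u v|y /bx]; first by rewrite linearPr.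
by rewrite memv_lker_linfun // => /eqP.
Qed.

Lemma memv_bol_center x :
  reflect (forall y z, x *b y = 0 /\ [b x, y, z] = 0) (x \in bol_center).
Proof.
have lm y : linear (fun x => x *b y) by move=> a u v; rewrite linearPl.
apply: (iffP (memv_bigcap _ _ _)) => [xC y z|xC y _]; last first.
  rewrite memv_cap memv_lker_linfun // (xC y 0).1 eqxx /=.
  apply/memv_bigcap=> z _; rewrite memv_lker_linfun ?(xC y z).2 //.
  exact: btri_linear.
have {}xC y' : y' \in vbasis {:B} ->
    x *b y' = 0 /\ (forall z', z' \in vbasis {:B} -> [b x, y', z'] = 0).
  move=> /xC; rewrite memv_cap memv_lker_linfun // => /andP[/eqP-> /memv_bigcap h].
  split=> // z' /h; rewrite memv_lker_linfun => [/eqP//|].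
  exact: btri_linear.
split.
  apply: (@vbasis_linear0 fullv B (bmul S x)) (memvf y) => [a u v|y' /xC[]//].
  by rewrite linearPr.
apply: (@vbasis_linear0 fullv B (fun t => [b x, t, z])) (memvf y) => [a u v|y'].
  by rewrite linearPl.
move=> /xC[_ xyC].
apply: (@vbasis_linear0 fullv B (fun t => [b x, y', t])) (memvf z) => // a u v.
by rewrite linearPr.
Qed.

Lemma bilinear_vbasis (f : {bilinear B -> B -> B}) (W : {vspace B}) :
  (forall x y, x \in vbasis {:B} -> y \in vbasis {:B} -> f x y \in W) ->
  forall x y, f x y \in W.
Proof.
move=> fW x y; rewrite (coord_vbasis (memvf x)) (coord_vbasis (memvf y)).
rewrite linear_sumlz rpred_sum // => i _; rewrite linearZl_LR /= rpredZ //.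
rewrite linear_sumr rpred_sum // => j _; rewrite linearZr_LR /= rpredZ //.
by rewrite fW // mem_nth ?size_tuple.
Qed.

Lemma bmulspan_subv (W : {vspace B}) :
  (bmulspan <= W)%VS <-> (forall x y, x *b y \in W).
Proof.
split=> [/subvP sW | mW].
  apply: bilinear_vbasis => x y xb yb; apply/sW/memv_span.
  by apply/allpairsP; exists (x, y).
by apply/span_subvP=> _ /allpairsP[p [_ _ ->]].
Qed.

Lemma btrispan_subv (W : {vspace B}) :
  (btrispan <= W)%VS <-> (forall x y z, [b x, y, z] \in W).
Proof.
split=> [/subvP sW x y z | mW]; last first.
  by apply/span_subvP=> _ /allpairsP[p [_ _ ->]].
rewrite (coord_vbasis (memvf x)).
pose F := GRing.isLinear.Build K B B *:%R (fun x => [b x, y, z])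
  (btri_linear S y z).
pose g : {linear B -> B} := HB.pack (fun x => [b x, y, z]) F.
rewrite -[btri S _ y z]/(g _) linear_sum rpred_sum // => i _.
rewrite linearZ /= rpredZ // {}/g {F}.
apply: (bilinear_vbasis (f := btri S _)) => {}y {}z yb zb; apply/sW/memv_span.
apply/allpairsP; exists (((vbasis {:B})`_i, y), z); split=> //.
by apply/allpairsP; exists ((vbasis {:B})`_i, y); rewrite mem_nth ?size_tuple.
Qed.

End BolSuperalgebraTheory.

(* Main.v *)
Require Import Defs.
From HB Require Import structures.
From mathcomp Require Import all_boot all_order all_algebra.

Set Implicit Arguments.
Unset Strict Implicit.
Unset Printing Implicit Defensive.

Import GRing.Theory.
Local Open Scope ring_scope.

(** For homogeneous arguments, super-anticommutativity turns the first invariance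
identity into the associativity law [b (x y) z = b x (y z)], which carries no
sign and so extends to all elements.  In the second identity,
[b [x, y, z] u = -+ b x [z, u, y]], the sign does not involve the parity of [x],
so the identity holds for arbitrary [x].  Hence [x] is orthogonal to [B B] and
to [[B, B, B]] iff all [x y] and [[x, y, z]] are orthogonal to [B]; when [b] is
nondegenerate this says that [x] is central.

For an ideal [I], homogeneity of [b] makes the orthogonal of [I] graded: in
[b x y = 0] with [y] homogeneous, only one component of [x] contributes.  All
elements may then be taken homogeneous, and invariance moves the products
through [b]: for [y] in the orthogonal of [I] and [u] in [I], [b (x y) u] is, up
to sign, [b y (x u)], and [b [x, y, z] u], after exchanging [x] and [y], is up to sign
[b y [z, u, x]]; both vanish because [x u] and [[z, u, x]] lie in [I]. *)

Section InvariantForm.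
Variables (K : fieldType) (B : vectType K) (S : bolSuperalgebra B).
Implicit Types (b : {biscalar B}) (I : {vspace B}) (P : B -> Prop).

Lemma btriDl x x' y z : btri S (x + x') y z = btri S x y z + btri S x' y z.
Proof. by have := btri_linear S y z 1 x x'; rewrite /= !scale1r. Qed.

Lemma graded_subspaceP I :
  reflect (forall x, x \in I -> exists x0 x1,
             [/\ x0 \in I, x0 \in hpart S false, x1 \in I,
                 x1 \in hpart S true & x = x0 + x1])
          (graded_subspace S I).
Proof.
apply: (iffP eqP) => [-> x /memv_addP[x0 x0I [x1 x1I ->]]|gI].
  exists x0, x1; split=> //.
  - by rewrite -[x0]addr0 memv_add ?mem0v.
  - by move: x0I; rewrite memv_cap => /andP[].
  - by rewrite -[x1]add0r memv_add ?mem0v.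
  - by move: x1I; rewrite memv_cap => /andP[].
apply/eqP; rewrite eqEsubv subv_add !capvSl !andbT.
apply/subvP=> x /gI[x0 [x1 [x0I x0h x1I x1h ->]]].
by rewrite memv_add // memv_cap ?x0I ?x1I.
Qed.

Lemma graded_ind I P :
    graded_subspace S I ->
    (forall x x', P x -> P x' -> P (x + x')) ->
    (forall i x, x \in I -> x \in hpart S i -> P x) ->
  forall x, x \in I -> P x.
Proof.
move=> /graded_subspaceP gI PD Ph x /gI[x0 [x1 [x0I x0h x1I x1h ->]]].
by apply: PD; [apply: Ph x0h | apply: Ph x1h].
Qed.

Lemma graded_fullv : graded_subspace S fullv.
Proof. by rewrite /graded_subspace !capfv hpart_full. Qed.

Lemma hpart_ind P :
    (forall x x', P x -> P x' -> P (x + x')) ->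
    (forall i x, x \in hpart S i -> P x) ->
  forall x, P x.
Proof.
move=> PD Ph x; apply: (graded_ind graded_fullv PD) (memvf x) => i y _.
exact: Ph.
Qed.

Lemma bol_ideal_fullv : bol_ideal S fullv.
Proof. by split=> [|x y _|x y z _]; rewrite ?graded_fullv ?memvf. Qed.

Lemma form_bmulA b x y z :
  invariant_form S b -> b (bmul S x y) z = b x (bmul S y z).
Proof.
case=> _ bM _; elim/hpart_ind: x => [x x' IHx IHx'|i x xi].
  by rewrite !linearDl IHx IHx'.
elim/hpart_ind: y => [y y' IHy IHy'|j y yj].
  by rewrite linearDr !linearDl linearDr IHy IHy'.
elim/hpart_ind: z => [z z' IHz IHz'|k z zk].
  by rewrite !linearDr IHz IHz'.
rewrite (BS1 xi yj) linearNl linearZl_LR /= (bM _ _ _ _ _ _ yj xi zk).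
by rewrite [j && i]andbC mulrN opprK mulrA -signr_addb addbb mul1r.
Qed.

Lemma form_btri_eq0 b j k l x y z u :
    invariant_form S b ->
    y \in hpart S j -> z \in hpart S k -> u \in hpart S l ->
  (b (btri S x y z) u == 0) = (b x (btri S z u y) == 0).
Proof.
case=> _ _ bT yj zk ul.
suff -> : b (btri S x y z) u
    = - ((-1) ^+ (j && (k (+) l)) * b x (btri S z u y)).
  by rewrite oppr_eq0 mulf_eq0 signr_eq0.
elim/hpart_ind: x => [x x' IHx IHx'|i x xi]; last exact: bT xi yj zk ul.
by rewrite btriDl !linearDl IHx IHx' mulrDr opprD.
Qed.

(** Sign-free form of the second invariance identity, for arbitrary elements. *)
Lemma form_btri_all_eq0 b x :
    invariant_form S b ->
  (forall y z u, b (btri S x y z) u = 0) <->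
  (forall y z u, b x (btri S y z u) = 0).
Proof.
move=> b_inv; split=> bx.
  move=> z u y.
  elim/hpart_ind: y => [y y' IHy IHy'|j y yj].
    by rewrite !linearDr IHy IHy' addr0.
  elim/hpart_ind: z => [z z' IHz IHz'|k z zk].
    by rewrite btriDl linearDr IHz IHz' addr0.
  elim/hpart_ind: u => [u u' IHu IHu'|l u ul].
    by rewrite linearDl linearDr IHu IHu' addr0.
  by apply/eqP; rewrite -(form_btri_eq0 _ b_inv yj zk ul) bx.
move=> y z u.
elim/hpart_ind: y => [y y' IHy IHy'|j y yj].
  by rewrite !linearDl IHy IHy' addr0.
elim/hpart_ind: z => [z z' IHz IHz'|k z zk].
  by rewrite linearDr linearDl IHz IHz' addr0.
elim/hpart_ind: u => [u u' IHu IHu'|l u ul].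
  by rewrite linearDr IHu IHu' addr0.
by apply/eqP; rewrite (form_btri_eq0 _ b_inv yj zk ul) bx.
Qed.

Lemma nondegenerate_form_eq0 b x :
  nondegenerate_form b -> (forall y, b x y = 0) -> x = 0.
Proof.
by move=> ndb bx; apply/eqP; rewrite -memv0 -ndb; apply/memv_form_perp=> y _.
Qed.

Lemma memv_form_perp_products b x :
  x \in form_perp b (bmulspan S + btrispan S)%VS <->
  (forall y z, b x (bmul S y z) = 0) /\ (forall y z u, b x (btri S y z u) = 0).
Proof.
have mulS := (bmulspan_subv S _).1 (subvv _).
have triS := (btrispan_subv S _).1 (subvv _).
split=> [/memv_form_perp bx | [bM bT]].
  split=> [y z|y z u]; apply: bx.
    by rewrite (subvP (addvSl _ _)).
  by rewrite (subvP (addvSr _ _)).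
(* Spans are tested through the kernel of the linear form [b x]. *)
pose W := lker (linfun (b x : B -> K^o)).
have lb : linear (b x : B -> K^o) by move=> a u v; rewrite linearPr.
have WE y : (y \in W) = (b x y == 0) by rewrite memv_lker_linfun.
apply/memv_form_perp=> y yS; apply/eqP; rewrite -WE.
apply: (subvP _) y yS; rewrite subv_add; apply/andP; split.
  by apply/bmulspan_subv=> y z; rewrite WE bM.
by apply/btrispan_subv=> y z u; rewrite WE bT.
Qed.

Lemma form_perp_products b :
    invariant_form S b -> nondegenerate_form b ->
  form_perp b (bmulspan S + btrispan S)%VS = bol_center S.
Proof.
move=> b_inv ndb; apply/vspaceP=> x; apply/idP/idP.
  move=> /memv_form_perp_products[bM /(form_btri_all_eq0 x b_inv) bT].
  apply/memv_bol_center=> y z; split; apply: nondegenerate_form_eq0 ndb _ => u //.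
  by rewrite form_bmulA.
move=> /memv_bol_center xC; apply/memv_form_perp_products; split=> [y z|].
  by rewrite -form_bmulA // (xC y 0).1 linear0l.
by apply/(form_btri_all_eq0 x b_inv) => y z u; rewrite (xC y z).2 linear0l.
Qed.

Lemma graded_form_perp b p I :
    homogeneous_form S p b -> graded_subspace S I ->
  graded_subspace S (form_perp b I).
Proof.
move=> hb gI; apply/graded_subspaceP=> x /memv_form_perp xI.
have /graded_subspaceP/(_ x (memvf x))[x0 [x1 [_ x0h _ x1h xE]]] := graded_fullv.
(* [b x0 y] and [b x1 y] add up to 0, and one of them is 0 by homogeneity. *)
have bxE j y : y \in I -> y \in hpart S j -> b x0 y = 0 /\ b x1 y = 0.
  move=> yI yj; have := xI y yI; rewrite xE linearDl.
  have [jp|jp] := eqVneq j p.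
    have -> : b x1 y = 0 by apply: hb x1h yj _; rewrite jp; case: (p).
    by rewrite addr0.
  have -> : b x0 y = 0 by apply: hb x0h yj _.
  by rewrite add0r.
exists x0, x1.
split=> //; apply/memv_form_perp; apply: (graded_ind gI) => [y y'|j y yI yj].
- by rewrite linearDr => -> ->; rewrite addr0.
- by have [] := bxE j y yI yj.
- by rewrite linearDr => -> ->; rewrite addr0.
- by have [] := bxE j y yI yj.
Qed.

Lemma bol_ideal_form_perp b p I :
    invariant_form S b -> homogeneous_form S p b ->
  bol_ideal S I -> bol_ideal S (form_perp b I).
Proof.
move=> b_inv hb [gI IM IT]; have [_ bM _] := b_inv.
have gJ := graded_form_perp hb gI.
split=> // [x y yJ|x y z yJ].
  elim/hpart_ind: x => [x x' xyJ x'yJ|i x xi]; first by rewrite linearDl rpredD.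
  move: y yJ; apply: (graded_ind gJ) => [y y' xyJ xy'J|j y yJ yj].
    by rewrite linearDr rpredD.
  apply/memv_form_perp; apply: (graded_ind gI) => [u u'|k u uI uk].
    by rewrite linearDr => -> ->; rewrite addr0.
  rewrite (bM _ _ _ _ _ _ xi yj uk).
  by rewrite (memv_form_perp _ _ _ yJ) ?mulr0 ?oppr0 ?IM.
elim/hpart_ind: x => [x x' xyJ x'yJ|i x xi]; first by rewrite btriDl rpredD.
elim/hpart_ind: z => [z z' zyJ z'yJ|k z zk]; first by rewrite linearDr rpredD.
move: y yJ; apply: (graded_ind gJ) => [y y' xyJ xy'J|j y yJ yj].
  by rewrite linearDl rpredD.
rewrite (BS2 xi yj zk) rpredN rpredZ //.
apply/memv_form_perp; apply: (graded_ind gI) => [u u'|l u uI ul].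
  by rewrite linearDr => -> ->; rewrite addr0.
apply/eqP; rewrite (form_btri_eq0 _ b_inv xi zk ul).
by rewrite (memv_form_perp _ _ _ yJ) ?IT.
Qed.

End InvariantForm.

Theorem lemma5p4 (K : fieldType) (charK : [pchar K] =i pred0)
    (B : vectType K) (S : bolSuperalgebra B)
    (b : {biscalar B}) (b_inv : invariant_form S b) :
  (nondegenerate_form b -> form_perp b (bmulspan S + btrispan S)%VS = bol_center S)
  /\
  (forall p : bool, homogeneous_form S p b ->
     (forall I : {vspace B}, bol_ideal S I -> bol_ideal S (form_perp b I))
     /\ bol_ideal S (form_perp b fullv)).
Proof.
split=> [|p hb]; first exact: form_perp_products.
have idealP I : bol_ideal S I -> bol_ideal S (form_perp b I).
  exact: bol_ideal_form_perp b_inv hb.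
by split=> //; apply/idealP/bol_ideal_fullv.
Qed.
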